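(* Let $\omega=\frac{-1+\sqrt{-3}}{2}$ and define the Lehmer-Euler numbers $W_n$ by $$\sum_{n=0}^\infty W_n\frac{t^n}{n!}=\frac{3}{e^{t}+e^{\omega t}+e^{\omega^2 t}}=\left(\sum_{l=0}^\infty\frac{t^{3l}}{(3l)!}\right)^{-1}.$$ Then for every integer $n\ge 0$, $$W_{9n}\equiv(-1)^n,\quad W_{9n+3}\equiv(-1)^{n-1},\quad W_{9n+6}\equiv(-1)^{n-1}\,8\pmod{3^3}.$$ In particular, for every integer $m\ge 0$, $$W_{18m}\equiv 1,\ W_{18m+3}\equiv -1,\ W_{18m+6}\equiv -8,\ W_{18m+9}\equiv -1,\ W_{18m+12}\equiv 1,\ W_{18m+15}\equiv 8\pmod{3^3}.$$
   Context: The numbers $W_{3n}$ are integers. *)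

(* Defs.v *)
From HB Require Import structures.
From mathcomp Require Import all_boot all_order all_algebra all_field.

Set Implicit Arguments.
Unset Strict Implicit.
Unset Printing Implicit Defensive.

Import Order.TTheory GRing.Theory Num.Theory.
Local Open Scope ring_scope.

(* A formal power series \sum_n f_n t^n is its coefficient sequence. *)
Definition fps := nat -> algC.

Definition fps_const (c : algC) : fps := fun n => if n == 0 then c else 0.

Definition fps_add (f g : fps) : fps := fun n => f n + g n.

Definition fps_mul (f g : fps) : fps :=
  fun n => \sum_(i < n.+1) f i * g (n - i)%N.

(* The first n coefficients of the inverse, obtained by solving f * g = 1
   degree by degree. *)
Fixpoint fps_inv_coefs (f : fps) (n : nat) : seq algC :=
  if n is m.+1 then
    let s := fps_inv_coefs f m in
    rcons s ((f 0)^-1 * ((m == 0)%:R - \sum_(i < m) s`_i * f (m - i)%N))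
  else [::].

(* Meaningful only when f 0 != 0, see fps_mulVf. *)
Definition fps_inv (f : fps) : fps := fun n => (fps_inv_coefs f n.+1)`_n.

Definition fps_div (f g : fps) : fps := fps_mul f (fps_inv g).

Lemma size_fps_inv_coefs f n : size (fps_inv_coefs f n) = n.
Proof. by elim: n => //= n IHn; rewrite size_rcons IHn. Qed.

Lemma nth_fps_inv_coefs f n i : (i < n)%N -> (fps_inv_coefs f n)`_i = fps_inv f i.
Proof.
elim: n => // n IHn; rewrite ltnS leq_eqVlt => /predU1P[-> //|lt_in].
by rewrite /= nth_rcons size_fps_inv_coefs lt_in IHn.
Qed.

Lemma fps_invE f n :
  fps_inv f n =
  (f 0)^-1 * ((n == 0)%:R - \sum_(i < n) fps_inv f i * f (n - i)%N).
Proof.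
rewrite {1}/fps_inv /= nth_rcons size_fps_inv_coefs ltnn eqxx.
by under eq_bigr => i _ do rewrite nth_fps_inv_coefs //.
Qed.

Lemma fps_mulVf f : f 0 != 0 -> fps_mul (fps_inv f) f =1 fps_const 1.
Proof.
move=> f0 n; rewrite /fps_mul big_ord_recr /= subnn fps_invE mulrC mulVKf //.
by rewrite addrC subrK /fps_const; case: eqP.
Qed.

(* e^{a t} *)
Definition fps_exp (a : algC) : fps := fun n => a ^+ n / n`!%:R.

(* \sum_n w_n t^n / n! *)
Definition egf (w : nat -> algC) : fps := fun n => w n / n`!%:R.

(* \sum_l t^{3l} / (3l)! *)
Definition fps_exp3 : fps := fun n => if (3 %| n)%N then n`!%:R^-1 else 0.

(* In algC, sqrtC (-3) is the square root of -3 with positive imaginary part. *)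
Definition omega : algC := (-1 + sqrtC (- 3)) / 2.

(* e^t + e^{omega t} + e^{omega^2 t} *)
Definition exp_sum : fps :=
  fps_add (fps_add (fps_exp 1) (fps_exp omega)) (fps_exp (omega ^+ 2)).

(* The values are in algC; (x == y %[mod e])%C means that x - y is a rational
   integer multiple of e, so for an integer y it entails that x is an integer. *)
Definition lehmer_euler (n : nat) : algC :=
  n`!%:R * fps_div (fps_const 3) exp_sum n.

Lemma lehmer_eulerP : egf lehmer_euler =1 fps_div (fps_const 3) exp_sum.
Proof.
move=> n; rewrite /egf /lehmer_euler mulrAC mulfV ?mul1r //.
by rewrite pnatr_eq0 -lt0n fact_gt0.
Qed.

(* exp_sum and fps_exp3 are invertible. *)
Lemma exp_sum0 : exp_sum 0 = 3.
Proof.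
by rewrite /exp_sum /fps_add /fps_exp !expr0 fact0 divr1; rewrite -[1]/(1%:R) -!natrD.
Qed.

Lemma fps_exp30 : fps_exp3 0 = 1.
Proof. by rewrite /fps_exp3 dvdn0 fact0 invr1. Qed.

(* Main.v *)
Require Import Defs.
From HB Require Import structures.
From mathcomp Require Import all_boot all_order all_algebra all_field.
From mathcomp Require Import ring.
Set Implicit Arguments.
Unset Strict Implicit.
Unset Printing Implicit Defensive.
Import Order.TTheory GRing.Theory Num.Theory.

(** Comparing coefficients in [exp_sum = 3 * fps_exp3] gives, for [n > 0], the
    recurrence [\sum_(i <= n, 3 %| n - i) 'C(n, i) W_i = 0], so it suffices that
    the claimed residues [b_i] (extended by [0] off the multiples of [3])
    satisfy it modulo 27.  As [b_(i+9) = - b_i], the sums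
    [\sum_i 'C(N, i) b_(j+i)] are governed by [(x + 1)^N] modulo [x^9 + 1].
    Since [x^9 + 1 = (x + 1)^9] modulo 3, [(x + 1)^27] vanishes modulo
    [(27, x^9 + 1)], and only the exponents [N < 27] remain to be checked. *)

(* Entry i is the residue of W_i modulo 27, for i < 18. *)
Definition lehmer_residues : seq nat :=
  [:: 1; 0; 0; 26; 0; 0; 19; 0; 0; 26; 0; 0; 1; 0; 0; 8; 0; 0].

Definition lehmer_residue n := nth 0 lehmer_residues (n %% 18).

(** The operator 1 + shift, that is, multiplication by x + 1, on 18-periodic sequences stored as one
    period. Reducing modulo 27 keeps the unary entries small under [vm_compute]. *)
Definition add_next (s : seq nat) : seq nat :=
  mkseq (fun i => (nth 0 s i + nth 0 s (i.+1 %% 18)) %% 27) 18.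

Lemma sum_binS N (f : nat -> nat) :
  \sum_(i < N.+2) 'C(N.+1, i) * f i =
  \sum_(i < N.+1) 'C(N, i) * f i + \sum_(i < N.+1) 'C(N, i) * f i.+1.
Proof.
rewrite big_ord_recl [X in X + _ = _]/= bin0.
under eq_bigr => i _ do rewrite lift0 binS mulnDl.
rewrite big_split /= addnA; congr (_ + _).
rewrite big_ord_recr /= bin_small // mul0n addn0.
by rewrite [RHS]big_ord_recl bin0.
Qed.

(** Pascal's rule splits the sum for N + 1 at j into those for N at j and j + 1, so the induction
    needs every offset j. *)
Lemma binomial_transform_residue N j :
  \sum_(i < N.+1) 'C(N, i) * lehmer_residue (j + i) =
  nth 0 (iter N add_next lehmer_residues) (j %% 18) %[mod 27].
Proof.
elim: N j => [|N IHN] j; first by rewrite big_ord1 bin0 mul1n addn0.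
rewrite (sum_binS N (fun i => lehmer_residue (j + i))) -modnDm IHN.
under eq_bigr => i _ do rewrite addnS -addSn.
have jS : (j %% 18).+1 %% 18 = j.+1 %% 18 by rewrite -addn1 modnDml addn1.
by rewrite IHN modnDm iterS nth_mkseq ?ltn_pmod // jS modn_mod.
Qed.

Lemma iter_add_next_small :
  all (fun N => (3 %| N) ==> (nth 0 (iter N add_next lehmer_residues) 0 == 0))
      (iota 1 26).
Proof. by vm_compute. Qed.

(** The base case is computed; [add_next] fixes the zero sequence, which settles all N >= 27 at
    once. *)
Lemma iter_add_next27 k :
  iter (k + 27) add_next lehmer_residues = nseq 18 0.
Proof. by elim: k => [|k IHk]; [vm_compute | rewrite addSn iterS IHk]. Qed.

Lemma dvdn_binomial_transform_residue N :
  0 < N -> 3 %| N -> 27 %| \sum_(i < N.+1) 'C(N, i) * lehmer_residue i.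
Proof.
move=> N0 N3; rewrite /dvdn (binomial_transform_residue N 0) mod0n.
have [ltN|leN] := ltnP N 27; last by rewrite -(subnK leN) iter_add_next27.
have /(allP iter_add_next_small) : N \in iota 1 26 by rewrite mem_iota N0.
by rewrite N3 /= => /eqP ->.
Qed.

Lemma lehmer_residue_ndvd3 n : ~~ (3 %| n) -> lehmer_residue n = 0.
Proof.
have residues0 :
    all (fun r => (3 %| r) || (nth 0 lehmer_residues r == 0)) (iota 0 18) by [].
(* As 3 divides 18, reduction modulo 18 preserves divisibility by 3. *)
rewrite /dvdn -(@modn_dvdm 18) // => n3.
have /(allP residues0) : n %% 18 \in iota 0 18 by rewrite mem_iota ltn_pmod.
by rewrite /dvdn (negPf n3) => /eqP.
Qed.

Local Open Scope ring_scope.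

Lemma omega_eq : omega ^+ 2 + omega + 1 = 0.
Proof.
have s2 : sqrtC (- 3) ^+ 2 = - 3 :> algC by rewrite sqrtCK.
rewrite /omega; set s := sqrtC _ in s2 *.
have -> : ((-1 + s) / 2) ^+ 2 + (-1 + s) / 2 + 1 = (s ^+ 2 + 3) / 4 by field.
by rewrite s2 addNr mul0r.
Qed.

Lemma omega3 : omega ^+ 3 = 1.
Proof.
apply/eqP; rewrite -subr_eq0.
have -> : omega ^+ 3 - 1 = (omega - 1) * (omega ^+ 2 + omega + 1) by ring.
by rewrite omega_eq mulr0.
Qed.

(** Only n modulo 3 matters; both nonzero classes give 1 + omega + omega^2 up to order. *)
Lemma sum_omegaX n : 1 + omega ^+ n + omega ^+ 2 ^+ n = if (3 %| n)%N then 3 else 0.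
Proof.
have omX : forall k, omega ^+ k = omega ^+ (k %% 3)%N.
  by move=> k; rewrite [in LHS](divn_eq k 3) exprD mulnC exprM omega3 expr1n mul1r.
rewrite -exprM mulnC exprM omX /dvdn.
have := ltn_pmod n (isT : (0 < 3)%N).
case: (n %% 3)%N => [|[|[|//]]] _ /=; first by rewrite !expr1n; ring.
  by rewrite expr1 -omega_eq; ring.
have -> : omega ^+ 2 ^+ 2 = omega by rewrite -exprM exprSr omega3 mul1r.
by rewrite -omega_eq; ring.
Qed.

Lemma exp_sumE n : exp_sum n = 3 * fps_exp3 n.
Proof.
rewrite /exp_sum /fps_add /fps_exp expr1n -!mulrDl sum_omegaX /fps_exp3.
by case: ifP => _; rewrite ?mul0r ?mulr0.
Qed.

Lemma fps_inv_scale (c : algC) f g :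
  (forall n, f n = c * g n) -> fps_inv f =1 (fun n => c^-1 * fps_inv g n).
Proof.
move=> fE n; elim/ltn_ind: n => n IHn.
have [c0|c0] := eqVneq c 0.
  (* Here both sides are 0, by the convention that 0 has inverse 0. *)
  by rewrite fps_invE fE c0 invr0 !mul0r invr0 mul0r.
rewrite !fps_invE fE invfM -!mulrA; congr (_ * (_ * (_ - _))).
by apply: eq_bigr => i _; rewrite IHn // fE mulrACA mulVf ?mul1r.
Qed.

Lemma fps_mul_const (c : algC) f n : fps_mul (fps_const c) f n = c * f n.
Proof.
rewrite /fps_mul big_ord_recl /fps_const /= subn0 big1 ?addr0 // => i _.
by rewrite mul0r.
Qed.

Lemma fps_div_exp_sum : fps_div (fps_const 3) exp_sum =1 fps_inv fps_exp3.
Proof.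
move=> n; rewrite /fps_div fps_mul_const (fps_inv_scale exp_sumE) mulVKf //.
by rewrite pnatr_eq0.
Qed.

(** This is [fps_invE] for [fps_exp3] multiplied by n!, where n! / (n - i)! = 'C(n, i) i!. *)
Lemma lehmer_euler_rec n :
  lehmer_euler n =
  (n == 0)%:R - \sum_(i < n | (3 %| n - i)%N) 'C(n, i)%:R * lehmer_euler i.
Proof.
have fact_neq0 k : k`!%:R != 0 :> algC by rewrite pnatr_eq0 -lt0n fact_gt0.
have lehmer_eulerE k : lehmer_euler k = k`!%:R * fps_inv fps_exp3 k.
  by rewrite /lehmer_euler fps_div_exp_sum.
rewrite lehmer_eulerE fps_invE fps_exp30 invr1 mul1r mulrBr; congr (_ - _).
  by case: n => [|n]; rewrite ?mulr0 // fact0 mulr1.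
rewrite mulr_sumr [RHS]big_mkcond; apply: eq_bigr => i _; rewrite /fps_exp3.
case: ifP => _; last by rewrite !mulr0.
rewrite lehmer_eulerE -(bin_fact (ltnW (ltn_ord i))) !natrM.
by field; rewrite fact_neq0.
Qed.

(** If 3 does not divide n, neither does it divide any i with 3 | n - i, so all terms vanish. If 3
    divides n, the filter only drops terms with zero residue, and the full binomial sum remains. *)
Lemma dvdn_residue_rec n : (0 < n)%N ->
  (27 %| \sum_(i < n | 3 %| n - i) 'C(n, i) * lehmer_residue i
         + lehmer_residue n)%N.
Proof.
move=> n_gt0; have [n3|n3] := boolP (3 %| n)%N; last first.
  rewrite lehmer_residue_ndvd3 // addn0 big1 // => i n_i.
  rewrite lehmer_residue_ndvd3 ?muln0 //; apply: contra n3 => i3.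
  by rewrite -(subnK (ltnW (ltn_ord i))) dvdn_add.
have := dvdn_binomial_transform_residue n_gt0 n3.
rewrite big_ord_recr /= binn mul1n; congr (_ %| _ + _)%N.
rewrite [RHS]big_mkcond; apply: eq_bigr => i _.
case: ifPn => //; rewrite dvdn_subr ?(ltnW (ltn_ord i)) // => i3.
by rewrite lehmer_residue_ndvd3 ?muln0.
Qed.

Lemma lehmer_euler_mod27 n :
  (lehmer_euler n == (lehmer_residue n)%:R %[mod (3 ^+ 3)%R])%C.
Proof.
have -> : 3 ^+ 3 = 27%:R :> algC by rewrite -natrX.
elim/ltn_ind: n => n IHn; rewrite lehmer_euler_rec.
have [->|n_gt0] := posnP n; first by rewrite big_ord0 subr0.
rewrite sub0r eqCmodN /eqCmod.
have := dvdn_residue_rec n_gt0; rewrite -dvdC_nat !nCdivE natrD => dvd27.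
rewrite opprK; set S := \sum_(i < n | _) _.
(* Replace each W_i in S by its residue: the error is divisible by 27 termwise by induction, the
   rest by [dvdn_residue_rec]. *)
rewrite -[S](subrK ((\sum_(i < n | 3 %| n - i) 'C(n, i) * lehmer_residue i)%N)%:R).
rewrite -addrA rpredD // natr_sum -sumrB rpred_sum // => i _.
by rewrite natrM -mulrBr dvdC_mull ?natr_int //; apply: IHn.
Qed.

(** The table holds representatives in [0, 27), while y is the signed one; they differ by 27 exactly
    when y is -1 or -8 in the uses below. *)
Lemma lehmer_euler_mod_period m r (y : algC) :
  (r < 18)%N -> (nth 0 lehmer_residues r)%:R - y \in [:: 0; 27] ->
  (lehmer_euler (18 * m + r)%N == y %[mod (3 ^+ 3)%R])%C.
Proof.
move=> r_lt residueE; apply: eqCmod_trans (lehmer_euler_mod27 _) _.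
rewrite /lehmer_residue mulnC modnMDl modn_small // /eqCmod.
have e27 : 3 ^+ 3 = 27 :> algC by rewrite -natrX.
by move: residueE; rewrite !inE => /pred2P[] ->; rewrite ?rpred0 // e27.
Qed.

(** The exponent is an integer since it equals -1 at n = 0. *)
Lemma exprz_pred_sign n : (-1) ^ (n%:Z - 1) = - (-1) ^+ n :> algC.
Proof.
by rewrite expfzDr ?oppr_eq0 ?oner_eq0 // exprN1 invrN1 mulrN1.
Qed.

Lemma lehmer_euler_mod18 m :
  [/\ (lehmer_euler (18 * m)%N == 1%R %[mod (3 ^+ 3)%R])%C,
      (lehmer_euler (18 * m + 3)%N == (-1)%R %[mod (3 ^+ 3)%R])%C
    & (lehmer_euler (18 * m + 6)%N == (- 8)%R %[mod (3 ^+ 3)%R])%C]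
  /\
  [/\ (lehmer_euler (18 * m + 9)%N == (-1)%R %[mod (3 ^+ 3)%R])%C,
      (lehmer_euler (18 * m + 12)%N == 1%R %[mod (3 ^+ 3)%R])%C
    & (lehmer_euler (18 * m + 15)%N == 8%R %[mod (3 ^+ 3)%R])%C].
Proof.
have nth_sub r (y k : algC) : (nth 0 lehmer_residues r)%:R = k + y ->
    k \in [:: 0; 27] -> (nth 0 lehmer_residues r)%:R - y \in [:: 0; 27].
  by move=> -> ?; rewrite addrK.
have in0 : (0 : algC) \in [:: 0; 27] by rewrite inE eqxx.
have in27 : (27 : algC) \in [:: 0; 27] by rewrite !inE eqxx orbT.
split; split; [rewrite -[X in lehmer_euler X]addn0| | | | |];
  apply: lehmer_euler_mod_period => //;
  by [apply: nth_sub in0; rewrite add0r | apply: nth_sub in27 => /=; ring].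
Qed.

Theorem theorem4 :
  (egf lehmer_euler =1 fps_div (fps_const 3) exp_sum
   /\ egf lehmer_euler =1 fps_inv fps_exp3)
  /\ (forall n : nat,
        [/\ (lehmer_euler (9 * n)%N == ((-1) ^+ n)%R %[mod (3 ^+ 3)%R])%C,
            (lehmer_euler (9 * n + 3)%N
               == ((-1) ^ (n%:Z - 1))%R %[mod (3 ^+ 3)%R])%C
          & (lehmer_euler (9 * n + 6)%N
               == ((-1) ^ (n%:Z - 1) * 8)%R %[mod (3 ^+ 3)%R])%C])
  /\ (forall m : nat,
        [/\ (lehmer_euler (18 * m)%N == 1%R %[mod (3 ^+ 3)%R])%C,
            (lehmer_euler (18 * m + 3)%N == (-1)%R %[mod (3 ^+ 3)%R])%C
          & (lehmer_euler (18 * m + 6)%N == (- 8)%R %[mod (3 ^+ 3)%R])%C]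
        /\
        [/\ (lehmer_euler (18 * m + 9)%N == (-1)%R %[mod (3 ^+ 3)%R])%C,
            (lehmer_euler (18 * m + 12)%N == 1%R %[mod (3 ^+ 3)%R])%C
          & (lehmer_euler (18 * m + 15)%N == 8%R %[mod (3 ^+ 3)%R])%C]).
Proof.
split; first by split=> n; rewrite lehmer_eulerP ?fps_div_exp_sum.
split=> [n|m]; last exact: lehmer_euler_mod18.
have [[mod0 mod3 mod6] [mod9 mod12 mod15]] := lehmer_euler_mod18 n./2.
rewrite !exprz_pred_sign -signr_odd.
(* The parity of n decides both the sign and which half of the period modulo 18 applies. *)
have -> : (9 * n = 18 * n./2 + 9 * odd n)%N.
  by rewrite -[in LHS](odd_double_half n) -mul2n mulnDr addnC mulnA.
case: (odd n); rewrite ?muln1 ?muln0 ?addn0 ?expr1 ?expr0 ?opprK ?mul1r ?mulN1r //.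
by rewrite -!(addnA _ 9).
Qed.
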